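(* The set of all nonempty factors of $D_\infty$ can be divided into two types (every nonempty factor is of exactly one of the two types) such that the following hold. (i) If $\omega$ is of the first type, then $\omega$ has exactly two distinct gaps, namely $G_1(\omega)$ and $G_2(\omega)$, and the gap sequence $\{G_p(\omega)\}_{p\ge1}$ is $\varphi_1(D_\infty)$, where $\varphi_1(a)=a$, $\varphi_1(b)=bb$, and the letters $a,b$ of $\varphi_1(D_\infty)$ are read as $G_1(\omega),G_2(\omega)$ respectively. (ii) If $\omega$ is of the second type, then $\omega$ has exactly three distinct gaps, namely $G_1(\omega)$, $G_2(\omega)$ and $G_4(\omega)$, and the gap sequence $\{G_p(\omega)\}_{p\ge1}$ is $\varphi_2(D_\infty)$, where $\varphi_2(a)=ab$, $\varphi_2(b)=acac$, and the letters $a,b,c$ of $\varphi_2(D_\infty)$ are read as $G_1(\omega),G_2(\omega),G_4(\omega)$ respectively.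
   Context: Let $\sigma$ be the morphism on $\{a,b\}^*$ with $\sigma(a)=ab$, $\sigma(b)=aa$. The Doubling sequence is $D_\infty=x_1x_2x_3\cdots=\sigma^\infty(a)=abaaabab\cdots$, the infinite fixed point of $\sigma$ beginning with $a$. Inverses of words are taken in the free group on $\{a,b\}$; $\varepsilon$ is the empty word. The maps $\varphi_1,\varphi_2$ are extended to infinite words by concatenation. Every factor $\omega$ of $D_\infty$ occurs infinitely often; $\omega_p$ ($p\ge1$) denotes its $p$-th occurrence, occurrences (overlaps allowed) being ordered by starting position. If $|\omega|=n$, $\omega_p=x_{i+1}\cdots x_{i+n}$ and $\omega_{p+1}=x_{j+1}\cdots x_{j+n}$, the gap $G_p(\omega)$ is $\varepsilon$ if $i+n=j$; $x_{i+n+1}\cdots x_j$ if $i+n<j$; and $(x_{j+1}\cdots x_{i+n})^{-1}$ if $i+n>j$. The set of gaps of $\omega$ is $\{G_p(\omega): p\ge 1\}$ and its gap sequence is the sequence $\{G_p(\omega)\}_{p\ge1}$. *)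

(* Defs.v *)
From HB Require Import structures.
From mathcomp Require Import all_boot.

Set Implicit Arguments.
Unset Strict Implicit.
Unset Printing Implicit Defensive.

(* Infinite words are functions from nat; they are indexed from 0, so the      *)
(* value at i is the letter x_{i+1} of the word x_1 x_2 x_3 ...                *)

Definition morph (A B : Type) (f : A -> seq B) (w : seq A) : seq B :=
  flatten (map f w).

(* When no f x is empty, the image of the first n+1 letters of u has length    *)
(* greater than n, so the value does not depend on the default x0.             *)
Definition morph_inf (A B : Type) (x0 : B) (f : A -> seq B) (u : nat -> A)
    (n : nat) : B :=
  nth x0 (morph f (mkseq u n.+1)) n.

Inductive letter2 : Set := a2 | b2.
Inductive letter3 : Set := a3 | b3 | c3.

Definition is_a2 (x : letter2) : bool := if x is a2 then true else false.
Definition letter2_of_bool (t : bool) : letter2 := if t then a2 else b2.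
Lemma is_a2K : cancel is_a2 letter2_of_bool. Proof. by case. Qed.
HB.instance Definition _ := Equality.copy letter2 (can_type is_a2K).

Definition sigma (x : letter2) : seq letter2 :=
  match x with a2 => [:: a2; b2] | b2 => [:: a2; a2] end.

Definition phi1 (x : letter2) : seq letter2 :=
  match x with a2 => [:: a2] | b2 => [:: b2; b2] end.

Definition phi2 (x : letter2) : seq letter3 :=
  match x with a2 => [:: a3; b3] | b2 => [:: a3; c3; a3; c3] end.

(* sigma^n(a) has length 2^n > n, and sigma^n(a) is a prefix of sigma^m(a)     *)
(* for n <= m, so this is the limit of the words sigma^n(a).                   *)
Definition Dinf (n : nat) : letter2 := nth a2 (iter n (morph sigma) [:: a2]) n.

Definition read2 (T : Type) (x y : T) (l : letter2) : T :=
  match l with a2 => x | b2 => y end.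

Definition read3 (T : Type) (x y z : T) (l : letter3) : T :=
  match l with a3 => x | b3 => y | c3 => z end.

Section FreeGroup.
Variable T : eqType.

(* (x, true) is the generator x and (x, false) its inverse. *)
Definition cancels (s t : T * bool) : bool := (s.1 == t.1) && (s.2 != t.2).

Definition reduced (w : seq (T * bool)) : bool :=
  sorted (fun s t => ~~ cancels s t) w.

(* The free group on T: each element is represented by its unique freely       *)
(* reduced word, so that group equality is Leibniz equality.                   *)
Record free_group := FreeGroup {
  fg_val :> seq (T * bool);
  fg_reduced : reduced fg_val }.

Lemma reduced_pos (w : seq T) : reduced [seq (x, true) | x <- w].
Proof.
rewrite /reduced sorted_map; case: w => //= x w.
by elim: w x => //= y w IHw x; rewrite IHw andbT /cancels /= andbF.
Qed.

Definition fg_word (w : seq T) : free_group := FreeGroup (reduced_pos w).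

Lemma reduced_inv (g : free_group) :
  reduced (rev [seq (s.1, ~~ s.2) | s <- g]).
Proof.
case: g => w red_w; rewrite /reduced -map_rev sorted_map rev_sorted.
rewrite -(eq_sorted (e := fun s t => ~~ cancels s t)) // => s t.
by rewrite /cancels /= eq_sym (inj_eq negb_inj) [t.2 == _]eq_sym.
Qed.

Definition fg_inv (g : free_group) : free_group := FreeGroup (reduced_inv g).

End FreeGroup.

Section Gaps.
Variables (T : eqType) (u : nat -> T).

(* x_{i+1} ... x_{i+n} *)
Definition subword (i n : nat) : seq T := mkseq (fun k => u (i + k)) n.

Definition occurs_at (w : seq T) (i : nat) : bool := subword i (size w) == w.

Definition is_factor (w : seq T) : Prop := exists i, occurs_at w i.

(* The p-th occurrence of w is x_{i+1} ... x_{i+|w|}: w occurs at i, and       *)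
(* exactly p of its occurrences start at or before i. In particular p >= 1.    *)
Definition is_occurrence (w : seq T) (p i : nat) : Prop :=
  occurs_at w i /\ count (occurs_at w) (iota 0 i.+1) = p.

(* If i + n = j, this is the word of length 0, i.e., the identity. *)
Definition gap_between (n i j : nat) : free_group T :=
  if i + n <= j then fg_word (subword (i + n) (j - (i + n)))
  else fg_inv (fg_word (subword j (i + n - j))).

Definition is_gap (w : seq T) (p : nat) (g : free_group T) : Prop :=
  exists i j : nat, [/\ is_occurrence w p i, is_occurrence w p.+1 j
                      & g = gap_between (size w) i j].

(* G p is G_p(w) for every p >= 1; the value G 0 is irrelevant. *)
Definition is_gap_sequence (w : seq T) (G : nat -> free_group T) : Prop :=
  forall p, 1 <= p -> is_gap w p (G p).

End Gaps.

(* Main.v *)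
Require Import Defs.
From mathcomp Require Import all_boot.
From mathcomp Require Import zify.

Set Implicit Arguments.
Unset Strict Implicit.
Unset Printing Implicit Defensive.

(** Every even-indexed letter of [Dinf] is [a], and the letter at [2k+1] is
the letter at [k] with [a] and [b] exchanged.  Hence a factor occurring at both
an even and an odd position is [a] or [aa]; the occurrences of any other factor
[w] are exactly the positions [2i+r], [r] fixed, where [i] runs through the
occurrences of a word [v], shorter than [w] unless [w = b], [v = a].  The words
read from one occurrence to the next ("return words") of [w] are the images under
[sigma], rotated by [r], of those of [v], so the pattern of the gaps is
inherited.  The word [a] has the pattern [phi1] because [sigma] itself lists its
occurrences, and [aa] occurs at [4m+2] and [4m+3] for each occurrence [m] of
[a], which turns [phi1] into [phi2]. *)

(** * Letters of [Dinf] at even and odd positions *)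

Definition flip2 (x : letter2) : letter2 := if x is a2 then b2 else a2.

Lemma flip2_inj : injective flip2.
Proof. by case; case. Qed.

Lemma size_morph_sigma w : size (morph sigma w) = (size w).*2.
Proof. by elim: w => //= -[] w /= ->. Qed.

Lemma nth_morph_sigma_even w i : nth a2 (morph sigma w) i.*2 = a2.
Proof. by elim: w i => [|[] w IHw] [|i] //=; rewrite ?nth_nil //; apply: IHw. Qed.

Lemma nth_morph_sigma_odd w i :
  i < size w -> nth a2 (morph sigma w) i.*2.+1 = flip2 (nth a2 w i).
Proof. by elim: w i => [|[] w IHw] [|i] //= ltiw; apply: IHw. Qed.

Lemma size_iter_sigma n : size (iter n (morph sigma) [:: a2]) = 2 ^ n.
Proof. by elim: n => //= n IHn; rewrite size_morph_sigma IHn expnS mul2n. Qed.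

(** Strong induction on [i]: even positions always carry [a], and an odd position [2k+1] is settled
    by position [k] of the previous iterate. *)
Lemma nth_iter_sigma i m n : i < 2 ^ m -> i < 2 ^ n ->
  nth a2 (iter m (morph sigma) [:: a2]) i =
  nth a2 (iter n (morph sigma) [:: a2]) i.
Proof.
have P0 k : nth a2 (iter k (morph sigma) [:: a2]) 0 = a2.
  by case: k => //= k; apply: (nth_morph_sigma_even _ 0).
elim/ltn_ind: i m n => -[|i] IHi m n; first by rewrite !P0.
case: m => [|m] //; case: n => [|n] //=.
rewrite -[i.+1]odd_double_half; case: (odd i.+1) => /=; last first.
  by rewrite !nth_morph_sigma_even.
rewrite !expnS add1n => ltm ltn.
rewrite !nth_morph_sigma_odd ?size_iter_sigma; try lia.
by congr flip2; apply: IHi; lia.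
Qed.

Lemma Dinf_even k : Dinf k.*2 = a2.
Proof. by case: k => // k; apply: nth_morph_sigma_even. Qed.

Lemma Dinf_odd k : Dinf k.*2.+1 = flip2 (Dinf k).
Proof.
have ltk n : n < 2 ^ n by apply: ltn_expl.
rewrite /Dinf /= nth_morph_sigma_odd.
  congr flip2; apply: nth_iter_sigma; last exact: ltk.
  by apply: leq_trans (ltk _) _; rewrite leq_pexp2l //; lia.
by rewrite size_iter_sigma; have := ltk k.*2; lia.
Qed.

(** * Factors read off by position *)

Lemma eq_subwordP (T : eqType) (u : nat -> T) i j n :
  subword u i n = subword u j n <-> forall k, k < n -> u (i + k) = u (j + k).
Proof.
split=> [eq_ij k ltkn | eq_ij].
  by have := congr1 (fun s => nth (u 0) s k) eq_ij; rewrite !nth_mkseq.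
by apply/eq_in_map => k; rewrite mem_iota => /eq_ij.
Qed.

Lemma size_subword (T : eqType) (u : nat -> T) i n : size (subword u i n) = n.
Proof. exact: size_mkseq. Qed.

Lemma drop_subword (T : eqType) (u : nat -> T) i n k :
  drop k (subword u i n) = subword u (i + k) (n - k).
Proof.
apply: (@eq_from_nth _ (u 0)); rewrite size_drop !size_subword // => l ltl.
rewrite nth_drop !nth_mkseq ?addnA //; lia.
Qed.

Lemma take_subword (T : eqType) (u : nat -> T) i n k :
  k <= n -> take k (subword u i n) = subword u i k.
Proof. by move=> lekn; rewrite -map_take take_iota (minn_idPl lekn). Qed.

Lemma subword_cons (T : eqType) (u : nat -> T) i n :
  subword u i n.+1 = u i :: subword u i.+1 n.
Proof.
rewrite /subword /mkseq /= addn0 (iotaDl 1 0) -map_comp; congr cons.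
by apply: eq_map => k /=; rewrite addnA addn1.
Qed.

Lemma subword_rcons (T : eqType) (u : nat -> T) i n :
  subword u i n.+1 = rcons (subword u i n) (u (i + n)).
Proof. exact: mkseqS. Qed.

(** Accounts for the rotation in the return words of a factor that occurs at odd positions. *)
Lemma rot1_subword (T : eqType) (u : nat -> T) i n :
  u (i + n) = u i -> rot 1 (subword u i n) = subword u i.+1 n.
Proof.
case: n => [|n] // eq_u.
by rewrite subword_cons rot1_cons subword_rcons addSn -addnS eq_u.
Qed.

Lemma morph_sigma_subword i n :
  morph sigma (subword Dinf i n) = subword Dinf i.*2 n.*2.
Proof.
apply: (@eq_from_nth _ a2); first by rewrite size_morph_sigma !size_subword.
move=> k; rewrite size_morph_sigma size_subword => ltk.
rewrite nth_mkseq //; move: ltk; rewrite -[k]odd_double_half.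
case: (odd k) => /= ltk; last by rewrite nth_morph_sigma_even -doubleD Dinf_even.
rewrite add1n nth_morph_sigma_odd ?size_subword; last lia.
by rewrite nth_mkseq ?addnS -?doubleD ?Dinf_odd //; lia.
Qed.

(** * Desubstitution of factors *)

Definition desubst_word (r : bool) (k n : nat) : seq letter2 :=
  subword Dinf k (r + n)./2.

(* The letters of [subword Dinf (2k+r) n] at even positions of [Dinf] carry no
information; those at odd positions determine, and are determined by, the
[(r + n) / 2] letters of [Dinf] starting at [k]. *)
Lemma occurs_at_desubst (r : bool) k n i :
  occurs_at Dinf (subword Dinf (r + k.*2) n) (r + i.*2) =
  occurs_at Dinf (desubst_word r k n) i.
Proof.
rewrite /occurs_at /desubst_word !size_subword.
apply/eqP/eqP => /eq_subwordP eq_ik; apply/eq_subwordP => t ltt.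
  apply: flip2_inj; rewrite -!Dinf_odd.
  have := eq_ik (t.*2.+1 - r).
  have -> : r + i.*2 + (t.*2.+1 - r) = (i + t).*2.+1 by case: (r); lia.
  have -> : r + k.*2 + (t.*2.+1 - r) = (k + t).*2.+1 by case: (r); lia.
  by apply; move: ltt; case: (r) => /=; lia.
have eq_t j : r + j.*2 + t = odd (r + t) + (j + (r + t)./2).*2.
  by rewrite doubleD -addnA addnCA -[in LHS](odd_double_half (r + t)); lia.
rewrite !eq_t; case: (boolP (odd (r + t))) => odd_t; last by rewrite !Dinf_even.
rewrite !add1n !Dinf_odd eq_ik //.
by move: odd_t ltt; case: (r) => /=; lia.
Qed.

Lemma occurs_at_both_parities w k l : w <> [::] ->
  occurs_at Dinf w k.*2 -> occurs_at Dinf w l.*2.+1 ->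
  w = [:: a2] \/ w = [:: a2; a2].
Proof.
rewrite /occurs_at => w0 /eqP wk /eqP wl.
have /eq_subwordP eq_kl := etrans wk (esym wl).
have De m : ~~ odd m -> Dinf m = a2.
  by move=> even_m; rewrite -[m]odd_double_half (negbTE even_m) Dinf_even.
have Dk m : m < size w -> ~~ odd m -> Dinf (l.*2.+1 + m) = a2.
  by move=> /eq_kl <- even_m; apply: De; rewrite oddD odd_double.
have [s1|[s2|s3]] : size w = 1 \/ size w = 2 \/ 2 < size w.
- by move: (w0); case: (w) => // x [|y [|z s]] //=; lia.
- by left; rewrite -wk s1 /subword /mkseq /= addn0 Dinf_even.
- right; rewrite -wk s2 /subword /mkseq /= addn0 Dinf_even eq_kl ?s2 // De //; lia.
(* With three letters, the even occurrence forces [a] at [2l+1] and [2l+3], so [Dinf] is [b] at both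
   [l] and [l+1]; but one of these is even. *)
have := Dk 0 (ltnW (ltnW s3)) isT; have := Dk 2 s3 isT.
rewrite addn0 (_ : l.*2.+1 + 2 = l.+1.*2.+1); last lia.
rewrite !Dinf_odd; case: (boolP (odd l)) => odd_l.
  by rewrite (De l.+1) //= negbK.
by rewrite (De l) //.
Qed.

Lemma occurs_at_a i : occurs_at Dinf [:: a2] i = (Dinf i == a2).
Proof. by rewrite /occurs_at /subword /mkseq /= addn0 eqseq_cons andbT. Qed.

Lemma occurs_at_b i : occurs_at Dinf [:: b2] i = (Dinf i == b2).
Proof. by rewrite /occurs_at /subword /mkseq /= addn0 eqseq_cons andbT. Qed.

(** * Return words and the gaps they determine *)

Lemma count_enumeration (P : pred nat) (e : nat -> nat) p :
  {homo e : i j / i < j} -> (forall i, P i <-> exists q, e q = i) ->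
  count P (iota 0 (e p).+1) = p.+1.
Proof.
move=> e_incr eP; rewrite -size_filter.
suff -> : filter P (iota 0 (e p).+1) = map e (iota 0 p.+1).
  by rewrite size_map size_iota.
(* Two strictly increasing lists with the same members are equal. *)
apply: (irr_sorted_eq ltn_trans ltnn).
- by apply: sorted_filter (iota_ltn_sorted _ _); apply: ltn_trans.
- by apply: homo_sorted (iota_ltn_sorted _ _) => i j; apply: e_incr.
move=> i; rewrite mem_filter mem_iota leq0n add0n ltnS.
apply/andP/mapP => [[/eP[q <-] leq]|[q]].
  by exists q; rewrite // mem_iota /= add0n ltnS -(leq_mono e_incr).
rewrite mem_iota /= add0n ltnS => leqp ->.
by rewrite (leq_mono e_incr) leqp; split=> //; apply/eP; exists q.
Qed.

(** The exponents are all positive on the left and all negative on the right, where at least one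
    letter remains. *)
Lemma fg_word_neq_inv (T : eqType) (s t : seq T) :
  t <> [::] -> fg_word s <> fg_inv (fg_word t).
Proof.
case: t => // x t _ /(congr1 (fun h : free_group T => all snd h)) /=.
by rewrite all_rev /= => /negP[]; elim: s.
Qed.

(* [e p] is the position of the occurrence number [p + 1] of [w], and the
return word starting there is [R (g p)]. *)
Record return_structure (L : Type) (w : seq letter2) (g : nat -> L)
    (e : nat -> nat) (R : L -> seq letter2) : Prop := ReturnStructure {
  return_occ : forall i, occurs_at Dinf w i <-> exists p, e p = i;
  return_step : forall p, e p.+1 = e p + size (R (g p));
  return_word : forall p, subword Dinf (e p) (size (R (g p))) = R (g p);
  return_pos : forall l, 0 < size (R l);
  return_inj : injective (size \o R) }.

Section ReturnStructureTheory.
Variables (L : Type) (w : seq letter2) (g : nat -> L).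
Variables (e : nat -> nat) (R : L -> seq letter2).
Hypothesis wR : return_structure w g e R.

Lemma return_incr : {homo e : i j / i < j}.
Proof.
apply: (homo_ltn ltn_trans) => p.
by rewrite (return_step wR) -[X in X < _]addn0 ltn_add2l (return_pos wR).
Qed.

Lemma is_occurrence_return p : is_occurrence Dinf w p.+1 (e p).
Proof.
split; first by apply/(return_occ wR); exists p.
exact: count_enumeration return_incr (return_occ wR).
Qed.

(** For a return word that occurs, one of [w] and [R l] is a prefix of the other, and this is the
    group element $w^{-1} R(l)$. *)
Definition gap_of_letter (l : L) : free_group letter2 :=
  if size w <= size (R l) then fg_word (drop (size w) (R l))
  else fg_inv (fg_word (drop (size (R l)) w)).

Lemma gap_between_return p :
  gap_between Dinf (size w) (e p) (e p.+1) = gap_of_letter (g p).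
Proof.
rewrite /gap_between /gap_of_letter (return_step wR) leq_add2l.
case: ifP => _; first by rewrite -[in RHS](return_word wR) drop_subword subnDl.
have /eqP <- : occurs_at Dinf w (e p) by apply/(return_occ wR); exists p.
by rewrite drop_subword size_subword subnDl.
Qed.

(** The length and the sign of the gap recover the length of [R l], and distinct letters have return
    words of distinct lengths. *)
Lemma gap_of_letter_inj : injective gap_of_letter.
Proof.
have drop_neq0 (s : seq letter2) n : (n < size s) -> drop n s <> [::].
  by move=> ltn /(congr1 size); rewrite size_drop /=; lia.
move=> l m; rewrite /gap_of_letter => eq_lm; apply: (return_inj wR) => /=.
move: eq_lm; case: leqP => lew; case: leqP => mew.
- move=> /(congr1 (fun h : free_group _ => size h)) /=.
  by rewrite !size_map !size_drop; lia.
- by move/fg_word_neq_inv => []; apply: drop_neq0.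
- by move/esym/fg_word_neq_inv => []; apply: drop_neq0.
move=> /(congr1 (fun h : free_group _ => size h)) /=.
by rewrite !size_rev !size_map !size_drop; lia.
Qed.

(** [e] counts occurrences from 0 while gaps are numbered from 1, hence the predecessor; the value
    at 0 is a dummy. *)
Definition return_gap (p : nat) : free_group letter2 :=
  gap_between Dinf (size w) (e p.-1) (e p).

Lemma return_gapS p : return_gap p.+1 = gap_of_letter (g p).
Proof. exact: gap_between_return. Qed.

Lemma is_gap_sequence_return : is_gap_sequence Dinf w return_gap.
Proof.
case=> // p _; exists (e p), (e p.+1).
by split; rewrite //; apply: is_occurrence_return.
Qed.

End ReturnStructureTheory.

(** Exactly [p + 1] occurrences of [w] start at or before [e p], which pins down [e p] from [w]
    alone. *)
Lemma return_enum_unique L L' w (g : nat -> L) (g' : nat -> L') e e' R R' :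
  return_structure w g e R -> return_structure w g' e' R' -> e =1 e'.
Proof.
move=> wR wR' p; have [occ_p cnt_p] := is_occurrence_return wR p.
have [q eq_q] := iffLR (return_occ wR' _) occ_p.
have [_ cnt_q] := is_occurrence_return wR' q.
have [pq] : p.+1 = q.+1 by rewrite -cnt_p -cnt_q eq_q.
by rewrite -eq_q pq.
Qed.

(** The image under [sigma] of a return word of the shorter word starts at [2 (e p)]. Moving the
    window to [2 (e p) + 1] rotates it, since the letter entering and the letter leaving are both
    [a]. Lengths double, so they stay distinct. *)
Lemma return_desubst L (r : bool) k n (g : nat -> L) e R :
  return_structure (desubst_word r k n) g e R ->
  (forall i, occurs_at Dinf (subword Dinf (r + k.*2) n) i -> odd i = r) ->
  return_structure (subword Dinf (r + k.*2) n) g (fun p => r + (e p).*2)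
    (fun l => rot r (morph sigma (R l))).
Proof.
move=> vR parity.
have sizeR l : size (rot r (morph sigma (R l))) = (size (R l)).*2.
  by rewrite size_rot size_morph_sigma.
split=> [i|p|p|l|l m /=].
- split=> [occ_i|[p <-]]; last first.
    by rewrite occurs_at_desubst; apply/(return_occ vR); exists p.
  have i_eq : i = r + i./2.*2 by rewrite -(parity i) // odd_double_half.
  move: occ_i; rewrite i_eq occurs_at_desubst => /(return_occ vR)[p <-].
  by exists p.
- by rewrite sizeR (return_step vR) doubleD addnA.
- rewrite sizeR -[in RHS](return_word vR) morph_sigma_subword.
  case: (r); last by rewrite rot0.
  by rewrite rot1_subword // -doubleD !Dinf_even.
- by rewrite sizeR double_gt0 (return_pos vR).
by rewrite !sizeR => /double_inj; apply: (return_inj vR).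
Qed.

(** * Blocks of the morphic image of an infinite word *)

Section MorphInf.
Variables (A B : Type) (x0 : B) (f : A -> seq B) (u : nat -> A).
Hypothesis f_pos : forall x, 0 < size (f x).

Definition block_start (k : nat) : nat := size (morph f (mkseq u k)).

Lemma morph_mkseqS k : morph f (mkseq u k.+1) = morph f (mkseq u k) ++ f (u k).
Proof.
by rewrite mkseqS /morph map_rcons flatten_rcons.
Qed.

Lemma block_startS k : block_start k.+1 = block_start k + size (f (u k)).
Proof. by rewrite /block_start morph_mkseqS size_cat. Qed.

Lemma leq_block_start k : k <= block_start k.
Proof.
elim: k => // k IHk; rewrite block_startS -addn1.
exact: leq_add IHk (f_pos _).
Qed.

Lemma morph_inf_block k j : j < size (f (u k)) ->
  morph_inf x0 f u (block_start k + j) = nth x0 (f (u k)) j.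
Proof.
move=> ltj; rewrite /morph_inf; have := leq_block_start k.
set p := _ + j => lek; have {lek} : k < p.+1 by rewrite ltnS /p; lia.
(* Once the prefix of [u] includes letter [k], lengthening it leaves block [k] unchanged. *)
elim: p.+1 => // n IHn; rewrite ltnS leq_eqVlt.
rewrite morph_mkseqS nth_cat -/(block_start n) => /predU1P[<-|ltkn].
  by rewrite /p ltnNge leq_addr /= addKn.
rewrite (IHn ltkn) /p.
suff le_start : block_start k.+1 <= block_start n.
  by rewrite (leq_trans _ le_start) // block_startS ltn_add2l.
elim: (n) ltkn => // m IHm; rewrite ltnS leq_eqVlt => /predU1P[->//|/IHm].
by move/leq_trans; apply; rewrite [X in _ <= X]block_startS leq_addr.
Qed.

Lemma block_decomposition p :
  exists k j, j < size (f (u k)) /\ p = block_start k + j.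
Proof.
elim: p => [|p [k [j [ltj ->]]]]; first by exists 0, 0; rewrite f_pos.
have [ltj1|] := ltnP j.+1 (size (f (u k))); first by exists k, j.+1; rewrite addnS.
by move=> lej; exists k.+1, 0; rewrite f_pos block_startS; split=> //; lia.
Qed.

End MorphInf.

(** * The two gap patterns *)

Definition phi1D : nat -> letter2 := morph_inf a2 phi1 Dinf.
Definition phi2D : nat -> letter3 := morph_inf a3 phi2 Dinf.

Lemma phi1_pos x : 0 < size (phi1 x). Proof. by case: x. Qed.
Lemma phi2_pos x : 0 < size (phi2 x). Proof. by case: x. Qed.

(** [phi2] is [phi1] followed by the substitution sending [a] to [ab] and [b] to [ac]. *)
Lemma phi2D_phi1D p :
  phi2D p = if odd p then read2 b3 c3 (phi1D p./2) else a3.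
Proof.
suff half q : phi2D q.*2 = a3 /\ phi2D q.*2.+1 = read2 b3 c3 (phi1D q).
  have [even_p odd_p] := half p./2; rewrite -[in LHS](odd_double_half p).
  by case: (odd p); rewrite ?add1n ?add0n.
have start2 k : block_start phi2 Dinf k = (block_start phi1 Dinf k).*2.
  by elim: k => // k IHk; rewrite !block_startS IHk doubleD; case: (Dinf k).
have [k [j [ltj ->]]] := block_decomposition Dinf phi1_pos q.
rewrite /phi2D /phi1D doubleD -start2 -addnS.
rewrite (morph_inf_block _ phi1_pos) // !(morph_inf_block _ phi2_pos).
- by move: ltj; case: (Dinf k); case: j => [|[|]].
- by move: ltj; case: (Dinf k) => /=; lia.
by move: ltj; case: (Dinf k) => /=; lia.
Qed.

(** * Occurrences and return words of [a], [b] and [aa] *)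

Definition return_a : letter2 -> seq letter2 := read2 [:: a2; b2] [:: a2].

Fixpoint occ_a (p : nat) : nat :=
  if p is q.+1 then occ_a q + size (return_a (phi1D q)) else 0.

Lemma phi1D_block k j : j < size (phi1 (Dinf k)) ->
  phi1D (block_start phi1 Dinf k + j) = Dinf k.
Proof.
move=> ltj; rewrite /phi1D (morph_inf_block _ phi1_pos) //.
by move: ltj; case: (Dinf k); case: j => [|[|]].
Qed.

(** The images [ab] and [aa] under [sigma] contain one and two letters [a], as many as [phi1] has
    letters; so letter [j] of block [k] of [phi1D] matches the [a] at offset [j] in the [k]-th
    image. *)
Lemma occ_a_block k j : j < size (phi1 (Dinf k)) ->
  occ_a (block_start phi1 Dinf k + j) = k.*2 + j.
Proof.
(* The bound on [i] includes the block length, so that the formula also yields the start of the next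
   block. *)
have in_block m i : occ_a (block_start phi1 Dinf m) = m.*2 ->
    i <= size (phi1 (Dinf m)) ->
    occ_a (block_start phi1 Dinf m + i) = if Dinf m is a2 then (m + i).*2
                                          else m.*2 + i.
  move=> E0; elim: i => [|i IHi] lei.
    by rewrite !addn0 E0; case: (Dinf m).
  rewrite addnS /= (IHi (ltnW lei)) phi1D_block //.
  by case: (Dinf m) => /=; lia.
have start m : occ_a (block_start phi1 Dinf m) = m.*2.
  elim: m => // m IHm; rewrite block_startS in_block //.
  by case: (Dinf m) => /=; lia.
move=> ltj; rewrite in_block ?(ltnW ltj) //.
by move: ltj; case: (Dinf k) => /=; lia.
Qed.

Lemma return_structure_a : return_structure [:: a2] phi1D occ_a return_a.
Proof.
have decomp := block_decomposition Dinf phi1_pos.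
split=> [i|p|p|[]|[] []] //.
- rewrite occurs_at_a; split.
    rewrite -[i]odd_double_half; case: (odd i) => [|_]; last first.
      exists (block_start phi1 Dinf i./2 + 0).
      by rewrite occ_a_block ?phi1_pos ?addn0.
    rewrite add1n Dinf_odd => Da; exists (block_start phi1 Dinf i./2 + 1).
    by rewrite occ_a_block ?addn1 //; move: Da; case: (Dinf i./2).
  case=> p <-; have [k [j [ltj ->]]] := decomp p.
  rewrite occ_a_block //; move: ltj; case: j => [|j].
    by rewrite addn0 Dinf_even.
  case Dk: (Dinf k) => //= ltj.
  by rewrite addnS (_ : j = 0) ?addn0 ?Dinf_odd ?Dk //; lia.
have [k [j [ltj ->]]] := decomp p.
rewrite occ_a_block // phi1D_block // /subword /mkseq.
case Dk: (Dinf k) ltj => /=; case: j => [|[|j]] //= _;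
  by rewrite ?addn0 ?addn1 ?Dinf_even ?Dinf_odd ?Dk.
Qed.

(** [b] is the letter at position 1 and desubstitutes to [a], the letter at position 0. The length
    does not drop, so this case stands outside the induction. *)
Lemma return_structure_b : exists e R, return_structure [:: b2] phi1D e R.
Proof.
have parity i : occurs_at Dinf (subword Dinf (true + 0.*2) 1) i -> odd i = true.
  rewrite occurs_at_b -[i]odd_double_half; case: (odd i).
    by rewrite add1n /= odd_double.
  by rewrite Dinf_even.
have := @return_desubst _ true 0 1 _ _ _ return_structure_a parity.
by do 2 eexists; eassumption.
Qed.

(** The first word leads from [4m+2] to [4m+3]; the others lead from [4m+3] to [4m'+2], where [m']
    is the next occurrence of [a] after [m], and have length [4(m'-m) - 1], that is 7 or 3. *)
Definition return_aa : letter3 -> seq letter2 :=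
  read3 [:: a2] [:: a2; a2; b2; a2; b2; a2; b2] [:: a2; a2; b2].

(** [aa] occurs at [2k] or [2k+1] precisely when letter [k] is [b], which means [k = 2m+1] with
    letter [m] equal to [a]. *)
Lemma occurs_at_aa i : occurs_at Dinf [:: a2; a2] i <->
  exists m (s : bool), Dinf m = a2 /\ i = 4 * m + 2 + s.
Proof.
have -> : occurs_at Dinf [:: a2; a2] i = (Dinf i == a2) && (Dinf i.+1 == a2).
  by rewrite /occurs_at /subword /mkseq /= addn0 addn1 !eqseq_cons andbT.
have half_b k : Dinf k = b2 <-> exists2 m, Dinf m = a2 & k = m.*2.+1.
  split=> [|[m Dm ->]]; last by rewrite Dinf_odd Dm.
  rewrite -[k]odd_double_half; case: (odd k); rewrite ?Dinf_even // add1n.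
  by rewrite Dinf_odd; case Dm: (Dinf k./2) => // _; exists k./2.
have aaE k (s : bool) :
    (Dinf (s + k.*2) == a2) && (Dinf (s + k.*2).+1 == a2) = (Dinf k == b2).
  case: s; rewrite ?add1n ?add0n -?doubleS ?Dinf_even ?Dinf_odd ?andbT /=;
  by case: (Dinf k).
split=> [|[m [s [Dm ->]]]].
  rewrite -[i]odd_double_half aaE => /eqP/half_b[m Dm ->].
  by exists m, (odd i); split=> //; lia.
have -> : 4 * m + 2 + s = s + m.*2.+1.*2 by lia.
by rewrite aaE; apply/eqP/half_b; exists m.
Qed.


(** Apply [sigma] twice to [v] followed by [a] and discard three letters. The extra [a] is needed
    because the window runs two letters past the image of [v]. *)
Lemma return_word_aa m l : let v := return_a l in
  subword Dinf m (size v) = v -> Dinf (m + size v) = a2 ->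
  let v' := return_aa (read2 b3 c3 l) in
  subword Dinf (4 * m + 3) (size v') = v'.
Proof.
move=> v vm am v'; have vam : subword Dinf m (size v).+1 = rcons v a2.
  by rewrite subword_rcons vm am.
have := congr1 (fun s => take (size v') (drop 3 (morph sigma (morph sigma s)))) vam.
rewrite !morph_sigma_subword drop_subword take_subword; last first.
  by rewrite /v' /v; case: (l).
have -> : m.*2.*2 + 3 = 4 * m + 3 by lia.
by move->; rewrite /v' /v; case: (l).
Qed.

Lemma return_structure_aa :
  return_structure [:: a2; a2] phi2D
    (fun p => 4 * occ_a p./2 + 2 + odd p) return_aa.
Proof.
have aR := return_structure_a.
have Docc p : Dinf (occ_a p) = a2.
  by apply/eqP; rewrite -occurs_at_a; apply/(return_occ aR); exists p.
split=> [i|p|p|[]|[] []] //.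
- rewrite occurs_at_aa; split=> [[m [s [/eqP Dm ->]]]|[p <-]]; last first.
    by exists (occ_a p./2), (odd p).
  move: Dm; rewrite -occurs_at_a => /(return_occ aR)[q <-].
  exists (s + q.*2); rewrite half_bit_double oddD odd_double addbF oddb //.
- rewrite phi2D_phi1D -[p.+1]addn1 -[p in p + 1]odd_double_half.
  case: (odd p); rewrite ?add1n ?add0n addn1.
    by rewrite -doubleS doubleK odd_double /=; case: (phi1D _) => /=; lia.
  by rewrite /= uphalf_double odd_double /=; lia.
rewrite phi2D_phi1D; case: (odd p).
  rewrite -addnA; apply: return_word_aa (return_word aR _) _.
  exact: (Docc p./2.+1).
rewrite (_ : _ + false = (occ_a p./2).*2.+1.*2); last lia.
by rewrite /subword /mkseq /= addn0 Dinf_even.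
Qed.

(** * The two types of factors *)

Definition type1 (w : seq letter2) : Prop :=
  exists e R, return_structure w phi1D e R.
Definition type2 (w : seq letter2) : Prop :=
  exists e R, return_structure w phi2D e R.

Lemma type12_disjoint w : type1 w -> type2 w -> False.
Proof.
move=> [e [R wR]] [e' [R' wR']]; have eqe := return_enum_unique wR wR'.
have eq_size p : size (R (phi1D p)) = size (R' (phi2D p)).
  apply: (@addnI (e p)); rewrite -(return_step wR) [in RHS]eqe.
  by rewrite -(return_step wR') eqe.
(* At indices 1 and 2 [phi1D] reads [b], [b], giving equal lengths, while [phi2D] reads [b], [a],
   giving distinct ones. *)
have := eq_size 1; rewrite -[phi1D 1]/(phi1D 2) eq_size.
by move/(return_inj wR').
Qed.

Lemma type_desubst (r : bool) k n :
  (forall i, occurs_at Dinf (subword Dinf (r + k.*2) n) i -> odd i = r) ->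
  let v := desubst_word r k n in let w := subword Dinf (r + k.*2) n in
  type1 v \/ type2 v -> type1 w \/ type2 w.
Proof.
move=> parity v w [] [e [R vR]]; [left | right];
  by have wR := return_desubst vR parity; do 2 eexists; apply: wR.
Qed.

Lemma type12_cover w : w <> [::] -> is_factor Dinf w -> type1 w \/ type2 w.
Proof.
elim/ltn_ind: {w}(size w) {-2}w (erefl (size w)) => n IHn w sw w0 [i occ_i].
have [->|/eqP wNa] := eqVneq w [:: a2].
  by left; exists occ_a, return_a; apply: return_structure_a.
have [->|/eqP wNaa] := eqVneq w [:: a2; a2].
  right; do 2 eexists; apply: return_structure_aa.
have [->|/eqP wNb] := eqVneq w [:: b2]; first by left; apply: return_structure_b.
have no_both k l : occurs_at Dinf w k.*2 -> occurs_at Dinf w l.*2.+1 -> False.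
  by move=> occk occl; case: (occurs_at_both_parities w0 occk occl).
have parity j : occurs_at Dinf w j -> odd j = odd i.
  move: occ_i; rewrite -[i]odd_double_half -[j]odd_double_half.
  rewrite !oddD !odd_double !addbF !oddb.
  by case: (odd i); case: (odd j); rewrite ?add1n ?add0n // => occ1 occ2;
    first [case: (no_both _ _ occ1 occ2) | case: (no_both _ _ occ2 occ1)].
have n2 : 1 < n.
  rewrite -sw; case: (w) w0 wNa wNb => [|x [|y s]] //.
  by case: x.
have w_eq : w = subword Dinf (odd i + i./2.*2) n.
  by rewrite odd_double_half -sw; move/eqP: occ_i.
rewrite w_eq; apply: type_desubst; first by move=> j; rewrite -w_eq; apply: parity.
(* From length 2 on, desubstitution strictly shortens the word and leaves it nonempty. *)
have lt_half : 0 < (odd i + n)./2 < n by case: (odd i) => /=; lia.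
case/andP: lt_half => half_gt0 half_lt.
apply: (IHn (odd i + n)./2); rewrite ?size_subword //.
  by move/(congr1 size); rewrite size_subword /=; lia.
by exists i./2; rewrite /occurs_at size_subword.
Qed.

Theorem mainTheorem1 :
  exists type1 type2 : seq letter2 -> Prop,
  [/\ forall w : seq letter2, w <> [::] -> is_factor Dinf w ->
        (type1 w /\ ~ type2 w) \/ (~ type1 w /\ type2 w),
      forall w : seq letter2, w <> [::] -> is_factor Dinf w -> type1 w ->
        exists G : nat -> free_group letter2,
        [/\ is_gap_sequence Dinf w G,
            G 1 <> G 2,
            forall g : free_group letter2,
              (exists p : nat, 1 <= p /\ G p = g) <-> (g = G 1 \/ g = G 2)
          & forall p : nat,
              G p.+1 = read2 (G 1) (G 2) (morph_inf a2 phi1 Dinf p)]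
    & forall w : seq letter2, w <> [::] -> is_factor Dinf w -> type2 w ->
        exists G : nat -> free_group letter2,
        [/\ is_gap_sequence Dinf w G,
            [/\ G 1 <> G 2, G 1 <> G 4 & G 2 <> G 4],
            forall g : free_group letter2,
              (exists p : nat, 1 <= p /\ G p = g) <->
              [\/ g = G 1, g = G 2 | g = G 4]
          & forall p : nat,
              G p.+1 = read3 (G 1) (G 2) (G 4) (morph_inf a3 phi2 Dinf p)]].
Proof.
exists type1, type2; split=> w w0 w_fact.
- have disj := @type12_disjoint w.
  by case: (type12_cover w0 w_fact) => tw; [left | right]; split=> // ?; apply: disj.
- case=> e [R wR]; exists (return_gap w e).
  have GE := return_gapS wR; have inj := gap_of_letter_inj wR.
  (* [phi1D] begins with [ab], so the first two gaps realise both letters. *)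
  rewrite (GE 0) (GE 1) -[phi1D 0]/a2 -[phi1D 1]/b2.
  split=> [||h|p].
  + exact: is_gap_sequence_return wR.
  + by move/inj.
  + split=> [[[|p] [//= _ <-]]|]; first rewrite GE.
      by case: (phi1D p); [left | right].
    by case=> ->; [exists 1 | exists 2]; rewrite GE.
  by rewrite GE -/(phi1D p); case: (phi1D p).
case=> e [R wR]; exists (return_gap w e).
have GE := return_gapS wR; have inj := gap_of_letter_inj wR.
(* [phi2D] begins with [abac]; [c] first appears at index 3, hence the fourth gap. *)
rewrite (GE 0) (GE 1) (GE 3) -[phi2D 0]/a3 -[phi2D 1]/b3 -[phi2D 3]/c3.
split=> [||h|p].
- exact: is_gap_sequence_return wR.
- by split=> /inj.
- split=> [[[|p] [//= _ <-]]|]; first rewrite GE.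
    by case: (phi2D p); [constructor 1 | constructor 2 | constructor 3].
  by case=> ->; [exists 1 | exists 2 | exists 4]; rewrite GE.
by rewrite GE -/(phi2D p); case: (phi2D p).
Qed.
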